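(* Let $p$ be a prime, $n\ge 1$ an integer, and let $\Omega$ be a tile in the elementary $p$-group $\mathbb{Z}_p^n$. (1) Case $p\ge 3$: if $\mathbb{Z}_p^n$ has the PT property, then $\Omega$ is a spectral set. (2) Case $p=2$: if $\mathbb{Z}_2^n$ and $\mathbb{Z}_2^{n-1}$ have the PT property, then $\Omega$ is a spectral set.
   Context: For a finite abelian group $G$ (written additively), a pair $(\Omega,T)$ of subsets of $G$ is a tiling pair if every $g\in G$ can be written uniquely as $g=\omega+t$ with $\omega\in\Omega$, $t\in T$; then $\Omega$ is called a tile. A nonempty subset $A\subset G$ is periodic if there is a nonzero $g\in G$ with $A+g=A$. $G$ has the periodic tiling property (PT property) if for every tiling pair $(\Omega,T)$ of $G$, either $\Omega$ is periodic, or there is a periodic set $T'\subset G$ such that $(\Omega,T')$ is also a tiling pair. Convention: the trivial group is regarded as having the PT property. A nonempty set $\Omega\subset G$ is spectral if there is a set $\Lambda\subset\widehat{G}$ of characters whose restrictions to $\Omega$ form an orthogonal basis of $L^2(\Omega)$; equivalently $|\Lambda|=|\Omega|$ and $\sum_{x\in\Omega}\chi(x)\overline{\chi'(x)}=0$ for all distinct $\chi,\chi'\in\Lambda$. *)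

(* Defs.v *)
From mathcomp Require Import all_boot all_order all_algebra.
From mathcomp Require Export reals complex.
Set Implicit Arguments.
Unset Strict Implicit.
Unset Printing Implicit Defensive.
Import GRing.Theory Num.Theory.
Local Open Scope ring_scope.

Definition tiling_pair (G : finZmodType) (Omega T : {set G}) : Prop :=
  forall g : G, exists! wt : G * G,
    [/\ wt.1 \in Omega, wt.2 \in T & g = wt.1 + wt.2].

Definition tile (G : finZmodType) (Omega : {set G}) : Prop :=
  exists T : {set G}, tiling_pair Omega T.

Definition periodic (G : finZmodType) (A : {set G}) : Prop :=
  A != set0 /\ exists2 g : G, g != 0 & [set a + g | a in A] = A.

(* The first disjunct is the convention that the trivial group has the
   property; without it, the tiling pair ({0}, {0}) would violate it. *)
Definition PT_property (G : finZmodType) : Prop :=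
  #|G| = 1%N \/
  forall Omega T : {set G}, tiling_pair Omega T ->
    periodic Omega \/ exists2 T' : {set G}, periodic T' & tiling_pair Omega T'.

Definition is_character (C : numClosedFieldType) (G : finZmodType)
    (chi : {ffun G -> C}) : Prop :=
  (forall x, `|chi x| = 1) /\ {morph chi : x y / x + y >-> x * y}.

Definition L2 (C : numClosedFieldType) (G : finZmodType) (Omega : {set G}) :=
  {ffun {x : G | x \in Omega} -> C^o}.

Definition L2_dot (C : numClosedFieldType) (G : finZmodType) (Omega : {set G})
    (f g : L2 C Omega) : C :=
  \sum_x (f x : C) * (g x : C)^*.

Definition restrict (C : numClosedFieldType) (G : finZmodType)
    (Omega : {set G}) (chi : {ffun G -> C}) : L2 C Omega :=
  [ffun x => chi (val x)].

(* The finite set of characters is given by its duplicate-free enumeration. *)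
Definition spectral (C : numClosedFieldType) (G : finZmodType)
    (Omega : {set G}) : Prop :=
  Omega != set0 /\
  exists Lambda : seq {ffun G -> C},
    [/\ uniq Lambda,
        {in Lambda, forall chi, is_character chi},
        {in Lambda &, forall chi chi', chi != chi' ->
           L2_dot (restrict Omega chi) (restrict Omega chi') = 0}
      & basis_of fullv [seq restrict Omega chi | chi <- Lambda]].

(* Main.v *)
(* Elementary p-groups inherit the PT property from larger ones as soon as the
   codimension k satisfies p^k >= 3: if A tiles G and K has at least three
   elements, shift by g <> 0 the copy of A over 0 in A x K.  The resulting tile
   of G x K is aperiodic when A is, so it has a periodic complement C, and the
   projection of C to G is a periodic complement of A.  For p = 2 codimension 1
   escapes this argument, whence the extra hypothesis.
   With the PT property in all dimensions, argue by induction on the dimension: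
   quotienting by the line of periods of the tile or of its complement yields a
   tiling one dimension lower.  Characters of the quotient lift to a spectrum of
   the tile, after multiplication by the characters of the line when it is the
   tile that is periodic. *)
From HB Require Import structures.
Require Import Defs.
From mathcomp Require Import all_boot all_order all_algebra.
From mathcomp Require Import reals complex.
Set Implicit Arguments.
Unset Strict Implicit.
Unset Printing Implicit Defensive.
Import GRing.Theory Num.Theory.
Local Open Scope ring_scope.

(** Joins the finite and the additive structure of a product, so that tilings of [G * K] make
    sense. *)
HB.instance Definition _ (G K : finZmodType) := GRing.Zmodule.on (G * K)%type.

(** * Tiling pairs and periods *)

Section Tilings.
Variable G : finZmodType.
Implicit Types (A B : {set G}) (g : G).

Lemma tiling_pairP A B : tiling_pair A B <->
  (forall g, exists a b, [/\ a \in A, b \in B & g = a + b]) /\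
  {in A & A, forall a a', {in B & B, forall b b',
     a + b = a' + b' -> a = a' /\ b = b'}}.
Proof.
split=> [tAB | [exAB injAB] g].
  split=> [g | a a' aA a'A b b' bB b'B eq_ab].
    by have [[a b] [[aA bB ->] _]] := tAB g; exists a, b.
  have [w [_ uniq_w]] := tAB (a + b).
  have wE := uniq_w (a, b) (And3 aA bB erefl).
  have wE' := uniq_w (a', b') (And3 a'A b'B eq_ab).
  by move: wE'; rewrite wE => -[-> ->].
have [a [b [aA bB ->]]] := exAB g.
exists (a, b); split=> // -[a' b'] /= [a'A b'B eq_ab].
by have [-> ->] := injAB a a' aA a'A b b' bB b'B eq_ab.
Qed.

Lemma tiling_pair_sym A B : tiling_pair A B -> tiling_pair B A.
Proof.
case/tiling_pairP=> exAB injAB; apply/tiling_pairP.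
split=> [g | b b' bB b'B a a' aA a'A].
  by have [a [b [aA bB ->]]] := exAB g; exists b, a; rewrite addrC.
rewrite addrC [b' + _]addrC => eq_ab.
by have [-> ->] := injAB a a' aA a'A b b' bB b'B eq_ab.
Qed.

Lemma add_in_setX A B :
    {in A & A, forall a a', {in B & B, forall b b',
       a + b = a' + b' -> a = a' /\ b = b'}} ->
  {in setX A B &, injective (fun ab : G * G => ab.1 + ab.2)}.
Proof.
move=> injAB [a b] [a' b'] /setXP[/= aA bB] /setXP[/= a'A b'B] eq_ab.
by have [-> ->] := injAB a a' aA a'A b b' bB b'B eq_ab.
Qed.

Lemma tiling_pair_card A B : tiling_pair A B -> (#|A| * #|B| = #|G|)%N.
Proof.
case/tiling_pairP=> exAB /add_in_setX/card_in_imset; rewrite cardsX => <-.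
rewrite -cardsT; congr #|pred_of_set _|; apply/setP=> g; rewrite inE.
have [a [b [aA bB ->]]] := exAB g.
by apply/imsetP; exists (a, b); rewrite // inE aA bB.
Qed.

(** The sums are pairwise distinct, so they form a set of [#|A| * #|B| = #|G|] elements, which is
    all of [G]. *)
Lemma card_tiling_pair A B :
    {in A & A, forall a a', {in B & B, forall b b',
       a + b = a' + b' -> a = a' /\ b = b'}} ->
  (#|A| * #|B| = #|G|)%N -> tiling_pair A B.
Proof.
move=> injAB cAB; apply/tiling_pairP; split=> // g.
have := card_in_imset (add_in_setX injAB); rewrite cardsX cAB => cI.
have : g \in [set ab.1 + ab.2 | ab in setX A B].
  suff -> : [set ab.1 + ab.2 | ab in setX A B] = setT by rewrite inE.
  by apply/eqP; rewrite eqEcard subsetT cardsT cI leqnn.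
by case/imsetP=> -[a b] /setXP[aA bB] ->; exists a, b.
Qed.

Lemma tiling_pair_neq0 A B : tiling_pair A B -> A != set0.
Proof.
case/tiling_pairP=> exAB _; have [a [b [aA _ _]]] := exAB 0.
by apply/set0Pn; exists a.
Qed.

Lemma mem_translate g A x :
  [set a + g | a in A] = A -> (x + g \in A) = (x \in A).
Proof. by move=> eqA; rewrite -{1}eqA (mem_imset A x (@addIr _ g)). Qed.

Lemma translate_id g A :
  {in A, forall x, x + g \in A} -> [set a + g | a in A] = A.
Proof.
move=> sA; apply/eqP; rewrite eqEcard card_imset ?leqnn ?andbT; last exact: addIr.
by apply/subsetP=> _ /imsetP[a aA ->]; apply: sA.
Qed.

Lemma periodic_or_aperiodic A : A != set0 ->
  periodic A \/ forall g, (forall x, (x + g \in A) = (x \in A)) -> g = 0.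
Proof.
move=> A0.
have [/existsP[g /andP[g0 /eqP sA]] | /existsPn no] :=
  boolP [exists g, (g != 0) && ([set a + g | a in A] == A)].
  by left; split=> //; exists g.
right=> g sA; have := no g; rewrite negb_and negbK => /orP[/eqP // | /eqP[]].
by apply: translate_id => x; rewrite sA.
Qed.

End Tilings.

(** * Invariance under isomorphism *)

Section Transport.
Variables (G H : finZmodType) (f : {additive G -> H}) (h : H -> G).
Hypotheses (fK : cancel f h) (hK : cancel h f).

Lemma tiling_pair_imset (A B : {set G}) :
  tiling_pair A B -> tiling_pair (f @: A) (f @: B).
Proof.
case/tiling_pairP=> exAB injAB; apply/tiling_pairP; split=> [g |].
  have [a [b [aA bB gE]]] := exAB (h g); exists (f a), (f b).
  by rewrite !imset_f // -raddfD -gE hK.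
move=> _ _ /imsetP[a aA ->] /imsetP[a' a'A ->] _ _ /imsetP[b bB ->] /imsetP[b' b'B ->].
rewrite -!raddfD => /(can_inj fK) eq_ab.
by have [-> ->] := injAB a a' aA a'A b b' bB b'B eq_ab.
Qed.

Lemma periodic_imset (A : {set G}) : periodic A -> periodic (f @: A).
Proof.
case=> A0 [g g0 sA]; split; first by rewrite imset_eq0.
exists (f g); first by rewrite raddf_eq0 //; apply: can_inj fK.
apply: translate_id => _ /imsetP[a aA ->].
by rewrite -raddfD imset_f ?mem_translate.
Qed.

End Transport.

Lemma can_imset (S T : finType) (f : S -> T) (h : T -> S) (A : {set T}) :
  cancel h f -> f @: (h @: A) = A.
Proof.
by move=> hK; rewrite -imset_comp (eq_imset _ (g := id)) ?imset_id.
Qed.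

Lemma PT_property_iso (G H : finZmodType) (f : {additive G -> H}) :
  bijective f -> PT_property G -> PT_property H.
Proof.
case=> h fK hK [G1 | PTG].
  by left; rewrite -G1; apply/esym/(@bij_eq_card _ _ f); exists h.
(* The inverse of a bijective additive map is additive; packed as a morphism, it lets the transport
   lemmas be used in both directions. *)
pose hM := GRing.isZmodMorphism.Build _ _ h (can2_zmod_morphism fK hK).
pose h' : {additive H -> G} := HB.pack h hM.
right=> A B tAB.
have [pA | [C pC tC]] := PTG _ _ (tiling_pair_imset (f := h') hK fK tAB).
  by left; rewrite -(can_imset A hK); apply: periodic_imset fK _ pA.
right; exists (f @: C); first exact: periodic_imset fK _ pC.
by rewrite -(can_imset A hK); apply: tiling_pair_imset fK hK _ _ tC.
Qed.

(** * Descent of the PT property to a factor *)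

Lemma card_ge3_avoid (T : finType) (x y : T) :
  (3 <= #|T|)%N -> exists2 z, z != x & z != y.
Proof.
move=> T3; have : ~~ ([set: T] \subset [set x; y]).
  apply/negP=> /subset_leq_card; rewrite cardsT cards2 => le.
  by have := leq_trans T3 le; case: (x != y).
by case/subsetPn=> z _; rewrite !inE negb_or => /andP[]; exists z.
Qed.

Section Descent.
Variables G K : finZmodType.
Hypothesis K_ge3 : (3 <= #|K|)%N.
Variables (A : {set G}) (g : G).

(* The copies of [A] over the points of [K], the one over [0] shifted by [g]. *)
Definition twist : {set (G * K)%type} :=
  [set x | x.1 - (if x.2 == 0 then g else 0) \in A].

(** Over each point of [K] the fibre of [twist] is a translate of [A], and a translate of [A] has
    the same complements as [A]. *)
Lemma twist_tiling (B : {set G}) :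
  tiling_pair A B -> tiling_pair twist (setX B [set 0]).
Proof.
case/tiling_pairP=> exAB injAB; apply/tiling_pairP; split=> [[x k]|].
  have [a [b [aA bB xE]]] := exAB (x - (if k == 0 then g else 0)).
  exists (a + (if k == 0 then g else 0), k), (b, 0).
  split; rewrite ?inE /= ?addrK ?bB ?eqxx //.
  by congr (_, _); rewrite ?addr0 // addrAC -xE subrK.
move=> [a k] [a' k']; rewrite !inE /= => aA a'A [b l] [b' l'].
rewrite !inE /= => /andP[bB /eqP->] /andP[b'B /eqP->] eq_ab.
have := congr1 fst eq_ab; have := congr1 snd eq_ab; rewrite /= !addr0.
move=> kE; rewrite -kE in a'A *; move=> eq1.
have [|e1 ->] := injAB _ _ aA a'A b b' bB b'B; last by rewrite (addIr _ e1).
by rewrite addrAC eq1 addrAC.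
Qed.

Lemma twist_aperiodic : g != 0 ->
  (forall x, (forall y, (y + x \in A) = (y \in A)) -> x = 0) -> ~ periodic twist.
Proof.
move=> g0 aper [_ [[v j] vj0 per]].
pose a (k : K) := if k == 0 then g else 0.
(* A period [(v, j)] carries the fibre over [i] onto the one over [i + j]. These are the translates
   of [A] by [a i] and [a (i + j)], and [A] has no nonzero period. *)
have vE i : v = a (i + j) - a i.
  apply/eqP; rewrite -subr_eq0 opprB; apply/eqP/aper=> y.
  have := mem_translate (y + a i, i) per; rewrite !inE /= -!/(a _) addrK => <-.
  by rewrite !addrA (addrAC y v).
have [j0 | j0] := eqVneq j 0.
  by case/eqP: vj0; rewrite (vE 0) j0 addr0 subrr.
(* From [- j] to [0] the shift jumps by [g], while from [i] to [i + j] it stays [0]. Both jumps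
   equal [v]. *)
have [i i0 ij] := card_ge3_avoid 0 (- j) K_ge3.
case/eqP: g0; have := vE (- j); rewrite (vE i) /a addNr eqxx oppr_eq0 (negPf i0).
by rewrite addr_eq0 (negPf ij) (negPf j0) !subr0.
Qed.

Lemma twist_complement (B : {set G}) (C : {set (G * K)%type}) :
    tiling_pair A B -> tiling_pair twist C -> periodic C ->
  periodic [set c.1 | c in C] /\ tiling_pair A [set c.1 | c in C].
Proof.
move=> tAB tC [C0 [[v j] vj0 perC]].
have /set0Pn[a0 a0A] := tiling_pair_neq0 tAB.
(* Since [k - l] and [k - l'] are nonzero, the two sums are lifted to the
     unshifted fibres of [twist], where they meet over the same [k]. *)
have injC : {in A &, forall a a', {in C &, forall c c',
    a + c.1 = a' + c'.1 -> a = a' /\ c = c'}}.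
  move=> a a' aA a'A [t l] [t' l'] cC c'C /= eq_at.
  have [k kl kl'] := card_ge3_avoid l l' K_ge3.
  have [_ injT] := (tiling_pairP _ _).1 tC.
  have aT : (a, k - l) \in twist by rewrite inE /= subr_eq0 (negPf kl) subr0.
  have a'T : (a', k - l') \in twist by rewrite inE /= subr_eq0 (negPf kl') subr0.
  have [|e1 ->] := injT _ _ aT a'T _ _ cC c'C; last by have := congr1 fst e1.
  by congr (_, _); rewrite //= !subrK.
have inj1 : {in C &, injective (fun c : G * K => c.1)}.
  move=> c c' cC c'C e.
  by have [] := injC a0 a0 a0A a0A c c' cC c'C (congr1 (+%R a0) e).
have tAC : tiling_pair A [set c.1 | c in C].
  apply: card_tiling_pair => [a a' aA a'A _ _ /imsetP[c cC ->] /imsetP[c' c'C ->] e |].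
    by have [-> ->] := injC a a' aA a'A c c' cC c'C e.
  (* [C] has as many elements as [B], because [C] and [setX B [set 0]] are both complements of
     [twist]. *)
  rewrite card_in_imset // -(tiling_pair_card tAB); congr (_ * _)%N.
  have := tiling_pair_card (twist_tiling tAB); rewrite -(tiling_pair_card tC).
  move/eqP; rewrite cardsX cards1 muln1 eqn_pmul2l; first by move/eqP.
  by rewrite card_gt0 (tiling_pair_neq0 tC).
split=> //; split; first by rewrite imset_eq0.
have moveC c : c \in C -> c + (v, j) \in C by rewrite mem_translate.
exists v.
  (* If [v = 0], then [c] and [c + (v, j)] have the same projection, so they coincide and [j = 0]
     too. *)
  apply: contraNneq vj0 => v0; have /set0Pn[c cC] := C0.
  have := inj1 c _ cC (moveC c cC); rewrite /= v0 addr0 => /(_ erefl) /eqP.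
  by rewrite eq_sym -[X in _ == X]addr0 (inj_eq (addrI c)).
apply: translate_id => _ /imsetP[c cC ->].
by apply/imsetP; exists (c + (v, j)); rewrite ?moveC.
Qed.

End Descent.

Lemma PT_property_fst (G K : finZmodType) :
  (3 <= #|K|)%N -> PT_property (G * K)%type -> PT_property G.
Proof.
move=> K3 PT; have [G1 | G1] := eqVneq #|G| 1%N; first by left.
right=> A B tAB.
have [| pA | aper] := periodic_or_aperiodic (A := A); rewrite ?(tiling_pair_neq0 tAB) //.
  by left.
have /card_gt0P[g] : (0 < #|[set~ (0%R : G)]|)%N.
  rewrite cardsC1 -subn1 subn_gt0 ltn_neqAle eq_sym G1.
  by apply/card_gt0P; exists 0%R.
rewrite !inE => g0.
right; have := twist_tiling (K := K) g tAB.
(* The convention on the trivial group is ruled out, as [G * K] has at least [#|K|] elements. *)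
case: PT => [GK1 | PT].
  have : (#|K| <= 1)%N.
    by rewrite -GK1 card_prod leq_pmull //; apply/card_gt0P; exists 0%R.
  by move/(leq_trans K3).
case/PT=> [/(twist_aperiodic K3 g0 aper) // | [C pC tC]].
have [pU tU] := twist_complement K3 tAB tC pC.
by exists [set c.1 | c in C].
Qed.

(** The last [m] coordinates are put first because [PT_property_fst] keeps the first factor. *)
Definition split_row (F : finFieldType) k m (x : 'rV[F]_(k + m)) :
  ('rV[F]_m * 'rV[F]_k)%type := (rsubmx x, lsubmx x).

Lemma split_row_is_additive (F : finFieldType) k m :
  zmod_morphism (@split_row F k m).
Proof. by move=> x y; rewrite /split_row !raddfB. Qed.

HB.instance Definition _ (F : finFieldType) k m :=
  GRing.isZmodMorphism.Build _ _ (@split_row F k m) (@split_row_is_additive F k m).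

Lemma PT_property_row (F : finFieldType) k m : (3 <= #|F| ^ k)%N ->
  PT_property 'rV[F]_(k + m) -> PT_property 'rV[F]_m.
Proof.
move=> Fk PT; apply: (@PT_property_fst _ 'rV[F]_k); first by rewrite card_mx mul1n.
apply: (@PT_property_iso _ _ (@split_row F k m)) PT.
exists (fun y : 'rV_m * 'rV_k => row_mx y.2 y.1) => [x | [y z]] /=.
  by rewrite hsubmxK.
by rewrite /split_row row_mxKl row_mxKr.
Qed.

(** * Spectra and their constructions *)

Section Characters.
Variable C : numClosedFieldType.

(** An indexed form of [spectral], with plain sums over [A], suited to pullbacks and products.
    Injectivity of the family is not demanded: for nonempty [A] it follows from orthogonality. *)
Definition has_spectrum (G : finZmodType) (A : {set G}) :=
  exists (I : finType) (e : I -> {ffun G -> C}),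
  [/\ #|I| = #|A|, forall i, is_character (e i)
    & forall i j, i != j -> \sum_(x in A) e i x * (e j x)^* = 0].

Lemma sum_character_sq (G : finZmodType) (A : {set G}) (chi : {ffun G -> C}) :
  is_character chi -> \sum_(x in A) chi x * (chi x)^* = #|A|%:R.
Proof.
move=> [chi1 _]; rewrite -sum1_card natr_sum; apply: eq_bigr => x _.
by rewrite -normCK chi1 expr1n.
Qed.

Lemma L2_dot_restrict (G : finZmodType) (A : {set G}) (chi chi' : {ffun G -> C}) :
  L2_dot (Defs.restrict A chi) (Defs.restrict A chi') = \sum_(x in A) chi x * (chi' x)^*.
Proof. by rewrite /L2_dot [RHS]big_sub; apply: eq_bigr => x _; rewrite !ffunE. Qed.

(** Orthogonal vectors of nonzero norm are free, and there are [#|A|] of them, which is the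
    dimension of [L2 C A]. *)
Lemma has_spectrum_spectral (G : finZmodType) (A : {set G}) :
  A != set0 -> has_spectrum A -> spectral C A.
Proof.
move=> A0 [I [e [cI che orth]]]; split=> //.
have nzA : #|A|%:R != 0 :> C by rewrite pnatr_eq0 -lt0n card_gt0.
have inj_e : injective e.
  move=> i j eq_e; apply/eqP; apply: contraNT nzA => ij.
  by rewrite -(sum_character_sq A (che i)) {2}eq_e orth.
pose X := [tuple e (enum_val i) | i < #|I|].
have XE i : tnth X i = e (enum_val i) by rewrite tnth_mktuple.
exists X; split.
- by rewrite map_inj_uniq ?enum_uniq // => i j /inj_e /enum_val_inj.
- by move=> _ /tnthP[i ->]; rewrite XE.
- move=> _ _ /tnthP[i ->] /tnthP[j ->]; rewrite !XE L2_dot_restrict => ij.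
  by apply: orth; apply: contraNneq ij => ->.
rewrite basisEfree subvf /= dimvf size_map size_tuple; apply/andP; split; last first.
  rewrite card_ord cI; change (#|{: {x : G | x \in A}}| * 1 <= #|A|)%N.
  by rewrite muln1 card_sig leq_eqVlt eqxx.
have nthE (i : 'I_#|I|) :
    (map_tuple (Defs.restrict A) X)`_i = Defs.restrict A (e (enum_val i)).
  by rewrite -tnth_nth tnth_map XE.
have scaleE c (v : L2 C A) x : (c *: v) x = c * (v x : C) :> C by rewrite ffunE.
apply/(@freeP _ _ _ (map_tuple (Defs.restrict A) X)) => k k0 j.
(* Pairing the vanishing combination with the character of index [j] leaves only [k j * #|A|%:R]. *)
have : L2_dot (0 : L2 C A) (Defs.restrict A (e (enum_val j))) = 0.
  by rewrite /L2_dot big1 // => x _; rewrite ffunE mul0r.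
rewrite -k0 /L2_dot.
under eq_bigr => x _ do rewrite sum_ffunE mulr_suml.
rewrite exchange_big /=.
under eq_bigr => i _ do
  (under eq_bigr => x _ do rewrite nthE scaleE -mulrA;
   rewrite -mulr_sumr -/(L2_dot _ _) L2_dot_restrict).
rewrite (bigD1 j) //= [X in _ + X]big1 => [|i ij].
  by move/eqP; rewrite addr0 sum_character_sq // mulf_eq0 (negPf nzA) orbF => /eqP.
by rewrite orth ?mulr0 // (inj_eq enum_val_inj).
Qed.

Lemma has_spectrum_imset (G H : finZmodType) (f : {additive G -> H}) (A : {set G}) :
  {in A &, injective f} -> has_spectrum (f @: A) -> has_spectrum A.
Proof.
move=> injf [I [e [cI che orth]]].
exists I, (fun i => [ffun x => e i (f x)]); split=> [|i|i j ij].
- by rewrite cI card_in_imset.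
- have [e1 eD] := che i; split=> [x|x y]; first by rewrite ffunE.
  by rewrite !ffunE raddfD eD.
rewrite -[RHS](orth i j ij) big_imset //=.
by apply: eq_bigr => x _; rewrite !ffunE.
Qed.

Lemma stable_setX (K Q : finZmodType) (A : {set (K * Q)%type}) :
  (forall k x, x \in A -> x + (k, 0) \in A) -> A = setX setT (snd @: A).
Proof.
move=> sA; apply/setP=> -[k y]; rewrite !inE /=; apply/idP/imsetP.
  by exists (k, y).
case=> -[k' y'] /= xA ->; have := sA (k - k') _ xA.
by congr (_ \in A); congr (_, _); rewrite /= ?addr0 // addrC subrK.
Qed.

(** The inner product of two product characters factors, and distinct index pairs differ in a
    component, whose factor vanishes. *)
Lemma has_spectrum_setX (K Q : finZmodType) (A : {set K}) (B : {set Q}) :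
  has_spectrum A -> has_spectrum B -> has_spectrum (setX A B).
Proof.
move=> [I [e [cI che orthe]]] [J [d [cJ chd orthd]]].
exists (I * J)%type, (fun ij => [ffun x => e ij.1 x.1 * d ij.2 x.2]).
split=> [|[i j] /=|[i j] [i' j'] ne /=]; first by rewrite card_prod cardsX cI cJ.
  have [[e1 eD] [d1 dD]] := (che i, chd j); split=> [x|x y].
    by rewrite ffunE normrM e1 d1 mulr1.
  by rewrite !ffunE /= eD dD mulrACA.
transitivity ((\sum_(x in A) e i x * (e i' x)^*) * (\sum_(y in B) d j y * (d j' y)^*)).
  rewrite big_distrlr pair_big /=; apply: eq_big => [x|x _]; first by rewrite inE.
  by rewrite !ffunE rmorphM /= mulrACA.
have [ii' | /orthe->] := eqVneq i i'; last by rewrite mul0r.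
have [jj' | /orthd->] := eqVneq j j'; last by rewrite mulr0.
by case/eqP: ne; rewrite ii' jj'.
Qed.

(** A root of [1 + X + ... + X^(p-1)] has order dividing [p]; order 1 would give [p = 0] in
    characteristic zero. *)
Lemma prime_root_exists p : prime p -> exists z : C, p.-primitive_root z.
Proof.
move=> p_pr; pose P : {poly C} := \poly_(i < p) 1.
have sP : size P = p by rewrite size_poly_eq ?oner_eq0 // prime_gt0.
have [z] : exists z, root P z.
  by apply/closed_rootP; rewrite sP; case: (p) p_pr => [|[]].
rewrite rootE horner_poly; under eq_bigr => i _ do rewrite mul1r.
move/eqP=> sz; have zp : z ^+ p = 1.
  by apply/eqP; rewrite -subr_eq0 subrX1 sz mulr0.
have [m mz m_p] := prim_order_exists (prime_gt0 p_pr) zp.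
have /primeP[_ /(_ m m_p)/pred2P[m1 | mp]] := p_pr; last by exists z; rewrite -mp.
move: mz sz; rewrite m1 => /prim_expr_order; rewrite expr1 => ->.
under eq_bigr => i _ do rewrite expr1n.
move/eqP; rewrite sumr_const card_ord pnatr_eq0 => /eqP p0.
by rewrite p0 in p_pr.
Qed.

(** The size [n.+2] is the shape to which ['F_p] unfolds. The inner products are geometric sums of
    ratio [u], with [u ^+ n.+2 = 1] and [u != 1]. *)
Lemma has_spectrum_cyclic n (z : C) :
  n.+2.-primitive_root z -> has_spectrum [set: 'I_n.+2].
Proof.
move=> zP; have zn := prim_expr_order zP.
have z1 : `|z| = 1.
  by apply/eqP; rewrite -(pexpr_eq1 (n := n.+2)) // -normrX zn normr1.
exists 'I_n.+2, (fun i : 'I_n.+2 => [ffun x : 'I_n.+2 => (z ^+ i) ^+ x]).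
split=> [|i|i j ij].
- by rewrite cardsT.
- split=> [x|x y]; first by rewrite ffunE !normrX z1 !expr1n.
  by rewrite !ffunE -exprD /= expr_mod // exprAC zn expr1n.
pose u := z ^+ i * (z ^+ j)^*.
have u1 : u - 1 != 0.
  apply: contraNneq ij => /eqP; rewrite subr_eq0 => /eqP uE.
  (* Since [z ^+ j] has modulus 1, the left side is [z ^+ i], and primitivity of [z] then gives
     [i = j]. *)
  have : u * z ^+ j = z ^+ j by rewrite uE mul1r.
  rewrite /u -mulrA [_^* * _]mulrC -normCK normrX z1 !expr1n mulr1 => /eqP.
  by rewrite (eq_prim_root_expr zP) !modn_small.
apply/eqP; rewrite -(mulrI_eq0 _ (mulfI u1)).
rewrite (eq_bigl predT) => [|x]; last by rewrite inE.
under eq_bigr => x _ do rewrite !ffunE rmorphXn -exprMn -/u.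
by rewrite -subrX1 /u exprMn -rmorphXn exprAC zn expr1n exprAC zn expr1n rmorph1 mulr1 subrr.
Qed.

Lemma has_spectrum_Fp p : prime p -> has_spectrum [set: 'F_p].
Proof.
move=> p_pr; have [z zP] := prime_root_exists p_pr.
by apply: (@has_spectrum_cyclic _ z); rewrite Fp_cast.
Qed.

End Characters.

(** * Tilings modulo a subgroup of periods *)

Section Projection.
Variables K Q : finZmodType.
Implicit Types A B : {set (K * Q)%type}.

Lemma tiling_pair_snd A B :
    (forall k x, x \in B -> x + (k, 0) \in B) -> tiling_pair A B ->
  {in A &, injective snd} /\ tiling_pair (snd @: A) (snd @: B).
Proof.
move=> sB /tiling_pairP[exAB injAB].
have inj a a' b b' : a \in A -> a' \in A -> b \in B -> b' \in B ->
    a.2 + b.2 = a'.2 + b'.2 -> a = a' /\ b.2 = b'.2.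
  case: a a' b b' => [k x] [k' x'] [l y] [l' y'] aA a'A bB b'B /= eq2.
  (* The stability of [B] allows [b'] to be moved along [K] until the first coordinates agree as
     well; uniqueness in the product then applies. *)
  have [|-> /(congr1 snd)] := injAB _ _ aA a'A _ _ bB (sB (k + l - k' - l') _ b'B).
    congr (_, _) => /=; last by rewrite addr0.
    by rewrite [RHS]addrA [RHS]addrC -(addrA (k + l)) -opprD subrK.
  by rewrite /= addr0.
split=> [a a' aA a'A eq2|].
  have [_ [b [_ bB _]]] := exAB 0.
  by have [] := inj a a' b b aA a'A bB bB (congr1 (+%R^~ b.2) eq2).
apply/tiling_pairP; split=> [y|].
  have [a [b [aA bB abE]]] := exAB (0, y).
  by exists a.2, b.2; rewrite !imset_f //; split=> //; have := congr1 snd abE.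
move=> _ _ /imsetP[a aA ->] /imsetP[a' a'A ->] _ _ /imsetP[b bB ->] /imsetP[b' b'B ->].
by case/inj=> // ->.
Qed.

Lemma has_spectrum_project (C : numClosedFieldType) A B :
    has_spectrum C [set: K] ->
    (forall D : {set Q}, tile D -> has_spectrum C D) -> tiling_pair A B ->
    (forall k x, x \in A -> x + (k, 0) \in A) \/
      (forall k x, x \in B -> x + (k, 0) \in B) ->
  has_spectrum C A.
Proof.
move=> spK spQ tAB [sA | sB].
  (* The same projection with the roles of [A] and [B] exchanged. *)
  have [_ /tiling_pair_sym t2] := tiling_pair_snd sA (tiling_pair_sym tAB).
  rewrite (stable_setX sA); apply: has_spectrum_setX => //.
  by apply: spQ; exists (snd @: B).
have [inj2 t2] := tiling_pair_snd sB tAB.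
by apply: (has_spectrum_imset inj2); apply: spQ; exists (snd @: B).
Qed.

End Projection.

(** * Coordinates adapted to a period *)

Section RowPeriod.
Variables (F : finFieldType) (m : nat) (j : 'I_m.+1) (g : 'rV[F]_m.+1).

(** The coefficient along [g], then the remainder; when [g 0 j != 0], the remainder has [j]-th entry
    zero, so [col'] loses nothing. *)
Definition row_coord (x : 'rV[F]_m.+1) : (F * 'rV[F]_m)%type :=
  (x 0 j / g 0 j, col' j (x - (x 0 j / g 0 j) *: g)).

Lemma row_coord_is_additive : zmod_morphism row_coord.
Proof.
move=> x y; congr (_, _); first by rewrite !mxE mulrBl.
rewrite -[RHS]/(col' j _ - col' j _) -raddfB; congr (col' j _); rewrite !mxE mulrBl scalerBl.
by rewrite !opprD !opprK addrACA.
Qed.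

HB.instance Definition _ :=
  GRing.isZmodMorphism.Build _ _ row_coord row_coord_is_additive.

Hypothesis gj : g 0 j != 0.

Lemma row_coord_period : row_coord g = (1, 0).
Proof. by rewrite /row_coord divff // scale1r subrr raddf0. Qed.

Lemma row_coord_bij : bijective row_coord.
Proof.
apply: inj_card_bij; last by rewrite card_prod !card_mx !mul1n expnS.
apply: raddf_inj => x [/eqP]; rewrite mulf_eq0 invr_eq0 (negPf gj) orbF => /eqP x0.
rewrite x0 mul0r scale0r subr0 => /matrixP x'0.
apply/matrixP=> i k; rewrite ord1 mxE.
have [k' -> | -> //] := unliftP j k.
by have := x'0 0 k'; rewrite !mxE.
Qed.

End RowPeriod.

(** * Induction on the dimension *)

Lemma stable_Fp p (Q : finZmodType) (A : {set ('F_p * Q)%type}) :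
    (forall x, x \in A -> x + (1, 0) \in A) ->
  forall k x, x \in A -> x + (k, 0) \in A.
Proof.
(* Every element of ['F_p] is a natural multiple of 1, so stability under [(1, 0)] can be
   iterated. *)
move=> sA k x xA; rewrite -[k]natr_Zp; elim: (k : nat) => [|n IHn].
  by case: x xA => k0 y; congr (_ \in A); congr (_, _); rewrite /= addr0.
have := sA _ IHn; congr (_ \in A); congr (_, _) => /=.
  by rewrite -addrA -natr1.
by rewrite !addr0.
Qed.

Lemma PT_tile_has_spectrum (C : numClosedFieldType) p m : prime p ->
  (forall k, (k <= m)%N -> PT_property 'rV['F_p]_k) ->
  forall A : {set 'rV['F_p]_m}, tile A -> has_spectrum C A.
Proof.
move=> p_pr; elim: m => [_|m IHm PT] A [B tAB].
  (* In dimension 0 the tile is a point and the trivial character is a spectrum. *)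
  have cA : #|A| = 1%N.
    have := tiling_pair_card tAB; rewrite card_mx muln0 expn0.
    by move/eqP; rewrite muln_eq1 => /andP[/eqP].
  exists unit, (fun _ => [ffun=> 1]); split=> [||[] []] //; first by rewrite card_unit.
  by move=> _; split=> [x|x y]; rewrite !ffunE ?normr1 ?mulr1.
have {}IHm := IHm (fun k km => PT k (leqW km)).
have [] := PT m.+1 (leqnn _).
  move=> c1; have : (p ^ m.+1 == p ^ 0)%N.
    by rewrite -{1}(card_Fp p_pr) -[m.+1]mul1n -card_mx c1.
  by rewrite eqn_exp2l ?prime_gt1.
move=> /(_ A B tAB) PTA.
(* Both alternatives of the PT property are merged: [D] is the given complement if [A] is periodic,
   the periodic one otherwise. *)
have [D tAD pAD] : exists2 D, tiling_pair A D & periodic A \/ periodic D.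
  by case: PTA => [pA | [D pD tAD]]; [exists B => //; left | exists D => //; right].
have [g g0 sAD] : exists2 g, g != 0 &
    {in A, forall x, x + g \in A} \/ {in D, forall x, x + g \in D}.
  case: pAD => -[_ [g g0 sg]]; exists g => //; [left | right] => x;
    by rewrite mem_translate.
have /rV0Pn[j gj] := g0.
have injg := bij_inj (row_coord_bij gj); have [h fK hK] := row_coord_bij gj.
(* In the new coordinates [g] becomes [(1, 0)], so its multiples form the first factor. *)
apply: (@has_spectrum_imset _ _ _ (row_coord j g)) => [x y _ _ /injg //|].
have tf := tiling_pair_imset (f := row_coord j g) fK hK tAD.
apply: (has_spectrum_project (has_spectrum_Fp C p_pr) IHm tf).
have stable_image (E : {set 'rV_m.+1}) : {in E, forall x, x + g \in E} ->
    forall k x, x \in row_coord j g @: E -> x + (k, 0) \in row_coord j g @: E.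
  move=> sE; apply: stable_Fp => _ /imsetP[x xE ->].
  by rewrite -(row_coord_period gj) -raddfD imset_f ?sE.
by case: sAD => /stable_image; [left | right].
Qed.

(** * The cases of odd [p] and of [p = 2] *)

Theorem corollary1p12 (R : realType) (p n : nat) (hp : prime p)
    (hn : (1 <= n)%N) (Omega : {set 'rV['F_p]_n}) (hOmega : tile Omega) :
  ((3 <= p)%N -> PT_property 'rV['F_p]_n -> spectral R[i] Omega) /\
  (p = 2%N -> PT_property 'rV['F_p]_n -> PT_property 'rV['F_p]_(n.-1) ->
     spectral R[i] Omega).
Proof.
have PT_spectral : (forall k, (k <= n)%N -> PT_property 'rV['F_p]_k) ->
    spectral R[i] Omega.
  move=> PT; apply: has_spectrum_spectral.
    by have [T /tiling_pair_neq0] := hOmega.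
  exact: (PT_tile_has_spectrum _ hp PT).
have PT_lower k : (k <= n)%N -> (3 <= p ^ (n - k))%N ->
    PT_property 'rV['F_p]_n -> PT_property 'rV['F_p]_k.
  move=> kn pk; rewrite -{1}(subnK kn); apply: PT_property_row.
  by rewrite card_Fp.
split=> [p3 PTn | p2 PTn PTn1]; apply: PT_spectral => k.
  rewrite leq_eqVlt => /predU1P[-> // | kn]; apply: PT_lower PTn; first exact: ltnW.
  by rewrite (leq_trans p3) // -{1}[p]expn1 leq_exp2l ?prime_gt1 ?subn_gt0.
rewrite leq_eqVlt => /predU1P[-> // | kn].
(* Codimension 1 gives only [2 ^ 1 < 3] and is covered by the second hypothesis; from codimension 2
   on, [2 ^ 2 >= 3] suffices. *)
have [kn1 | kn1] := eqVneq k n.-1; first by rewrite kn1.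
apply: PT_lower PTn; first exact: ltnW.
have nk2 : (2 <= n - k)%N.
  by rewrite ltn_subRL addn1 -(prednK hn) ltnS ltn_neqAle kn1 -ltnS (prednK hn).
by rewrite p2 (@leq_trans (2 ^ 2)) // leq_exp2l.
Qed.
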